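(* Let $(A_\alpha)_{\alpha<\lambda}$ be a sequence of graph-like $\varphi$-sets in structures $(\mathcal{M}_\alpha)_{\alpha<\lambda}$ with a common language, such that $\mathrm{isoSh}(A_\alpha)=\mathrm{isoSh}(A_\delta)$ for all $\alpha,\delta<\lambda$. Let $\Gamma$ be the collection of $\leq$-minimal isomorphism types of finite graphs not in $\mathrm{isoSh}(A_0)$, and for each $\mathbb{H}\in\Gamma$ let $B_{\mathbb{H}}$ be a necessary set for $\mathbb{H}$ in $\mathrm{isoSh}(A_0)$. Then every $\lambda$-type of $\widehat{\mathcal{M}}=\prod_{\alpha<\lambda}\mathcal{M}_\alpha/\mathcal{D}$ that is an $(A_\alpha)$-type is realized in $\widehat{\mathcal{M}}$ if and only if every graph-like function $f:\mathcal{P}_\omega(\lambda)\to\mathcal{D}$ satisfying \[\bigcap_{\{a,b\}\in E^{\mathbb{H}}}f(\{x(a),x(b)\})\subseteq\bigcup_{\{c,d\}\in B_{\mathbb{H}}}f(\{x(c),x(d)\})\] for all $\mathbb{H}\in\Gamma$ and all injective functions $x:H\to\lambda$ has a multiplicative refinement.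
   Context: $\lambda$ is an infinite cardinal and $\mathcal{D}$ a regular ultrafilter on $\lambda$; $\mathcal{P}_\omega(\lambda)$ the finite subsets of $\lambda$, $[X]^2$ the 2-element subsets. Fix a formula $\varphi(\bar{x};\bar{y})$, $|\bar y|=n$. A $\varphi$-set in a structure $\mathcal{M}$ is a nonempty $A\subseteq M^n$; it is graph-like if for every finite $B\subseteq A$ with $|B|\ge2$, $\{\varphi(\bar{x};\bar{a}):\bar{a}\in B\}$ is consistent iff $\{\varphi(\bar x;\bar a):\bar a\in C\}$ is consistent for every $C\in[B]^2$. $\mathrm{Sh}(A)$ is the set of pairs $(\mathbb{G},\theta)$ where $\mathbb{G}$ is a simple graph on $\{1,\dots,m\}$ for some $m\geq1$, $\theta:\{1,\dots,m\}\to A$, $\mathcal{M}\models\exists\bar{x}\,\varphi(\bar{x};\theta(i))$ for each $i$, and distinct $i,j$ are adjacent iff $\mathcal{M}\models\exists\bar{x}(\varphi(\bar{x};\theta(i))\wedge\varphi(\bar{x};\theta(j)))$. $\mathrm{isoSh}(A)$ is the set of isomorphism types of graphs $\mathbb{G}$ with $(\mathbb{G},\theta)\in\mathrm{Sh}(A)$. For graphs, $\mathbb{H}\le\mathbb{G}$ means there is an injective homomorphism $\mathbb{H}\to\mathbb{G}$ that also preserves non-edges. For a graph $\mathbb{H}$ and a set $S$ of graphs (isomorphism types) none of which has $\mathbb{H}$ as $\le$-subgraph, a set $B\subseteq[H]^2\setminus E^{\mathbb{H}}$ is necessary for $\mathbb{H}$ in $S$ if whenever $\mathbb{G}\in S$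 and $\psi:\mathbb{H}\to\mathbb{G}$ is an injective graph homomorphism, some $\{\psi(a),\psi(b)\}$ with $\{a,b\}\in B$ is an edge of $\mathbb{G}$. A $\varphi$-type $p(\bar{x})=\{\varphi(\bar{x},\bar{a}_\beta):\beta<\lambda\}$ of $\widehat{\mathcal{M}}$ is an $(A_\alpha)$-type if its parameters have representatives $\bar r_\beta\in\prod_\alpha M_\alpha^n$ with $\bar{r}_\beta(\alpha)\in A_\alpha$ for all $\alpha,\beta$. A function $f:\mathcal{P}_\omega(\lambda)\to\mathcal{D}$ is graph-like if $f(\Delta)=\bigcap_{\Phi\in[\Delta]^2}f(\Phi)$ whenever $|\Delta|\ge2$. A multiplicative refinement of $f$ is $g:\mathcal{P}_\omega(\lambda)\to\mathcal{D}$ with $g(\Delta)\subseteq f(\Delta)$ and $g(\Delta\cup\Phi)=g(\Delta)\cap g(\Phi)$ for all $\Delta,\Phi$. *)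

(* Defs.v *)
From HB Require Import structures.
From mathcomp Require Export all_boot finmap generic_quotient.
From mathcomp Require Export boolp classical_sets functions cardinality filter.

Set Implicit Arguments.
Unset Strict Implicit.
Unset Printing Implicit Defensive.

Local Open Scope classical_set_scope.
Local Open Scope card_scope.
Local Open Scope quotient_scope.

Record language := Language {
  funsym : Type;
  funar : funsym -> nat;
  relsym : Type;
  relar : relsym -> nat }.

Inductive term (S : language) (V : Type) : Type :=
| Var of V
| App (s : funsym S) of 'I_(funar s) -> term S V.

(* Formulas with free variables in [V]; [None] is the variable bound by [Ex].
   The remaining connectives and [forall] are classically definable. *)
Inductive formula (S : language) (V : Type) : Type :=
| Eq of term S V & term S V
| Rel (s : relsym S) of 'I_(relar s) -> term S V
| Neg of formula S V
| And of formula S V & formula S V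
| Ex of formula S (option V).

Record structure (S : language) := Structure {
  carrier :> Type;
  carrier_inh : inhabited carrier;
  funint : forall s : funsym S, ('I_(funar s) -> carrier) -> carrier;
  relint : forall s : relsym S, ('I_(relar s) -> carrier) -> Prop }.

Fixpoint eval (S : language) (M : structure S) (V : Type) (v : V -> M)
    (t : term S V) : M :=
  match t with
  | Var x => v x
  | App s ts => funint (fun i => eval v (ts i))
  end.

Fixpoint sat (S : language) (M : structure S) (V : Type) (p : formula S V) :
    (V -> M) -> Prop :=
  match p with
  | Eq t u => fun v => eval v t = eval v u
  | Rel s ts => fun v => relint (fun i => eval v (ts i))
  | Neg q => fun v => ~ sat q v
  | And q r => fun v => sat q v /\ sat r v
  | Ex q => fun v => exists c : M, sat q (fun o => if o is Some x then v x else c)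
  end.

(* A formula with its free variables partitioned into an m-tuple and an
   n-tuple. *)
Definition pformula (S : language) (m n : nat) := formula S ('I_m + 'I_n).

Definition power (M : Type) (n : nat) := 'I_n -> M.

Definition psat (S : language) (m n : nat) (phi : pformula S m n)
    (M : structure S) (x : power M m) (y : power M n) : Prop :=
  sat phi (fun i => match i with inl j => x j | inr j => y j end).

(* Consistency of {phi(x; a) : a in P}, i.e. finite satisfiability in M. *)
Definition consistent (S : language) (m n : nat) (phi : pformula S m n)
    (M : structure S) (P : set (power M n)) : Prop :=
  forall C : set (power M n), finite_set C -> C `<=` P ->
    exists x : power M m, forall a, C a -> psat phi x a.

Section Ultraproduct.
Variables (S : language) (L : Type) (D : set_system L) (M : L -> structure S).

Definition ueq (r s : forall i, M i) : Prop := D [set i | r i = s i].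

Definition ucarrier : Type :=
  {C : set (forall i, M i) | exists r, C = ueq r}.

Definition uclass (r : forall i, M i) : ucarrier :=
  exist _ (ueq r) (ex_intro _ r erefl).

Definition urepr (c : ucarrier) : forall i, M i := projT1 (cid (proj2_sig c)).

Lemma ucarrier_inh : inhabited ucarrier.
Proof.
have [r _] : exists r : forall i, M i, True.
  suff r : forall i, M i by exists r.
  move=> i; suff /cid[] : exists c : M i, True by [].
  by case: (carrier_inh (M i)) => c; exists c.
exact: inhabits (uclass r).
Qed.

(* When D is a filter the interpretations below do not depend on the
   representatives chosen by [urepr]. *)
Definition ultraproduct : structure S :=
  @Structure S ucarrier ucarrier_inh
    (fun s cs => uclass (fun i => funint (fun k => urepr (cs k) i)))
    (fun s cs => D [set i | relint (fun k => urepr (cs k) i)]).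

End Ultraproduct.

(* |L|-regularity: a family of |L| many members of D such that every point
   lies in finitely many of them. *)
Definition regular_system (L : Type) (D : set_system L) : Prop :=
  exists E : set (set L), [/\ E `<=` D, E #= [set: L] &
    forall i : L, finite_set [set X | E X /\ X i]].

Record fgraph := FGraph {
  order : nat;
  order_gt0 : (0 < order)%N;
  adj : rel 'I_order;
  adj_sym : symmetric adj;
  adj_irr : irreflexive adj }.

Definition vertex (G : fgraph) : finType := 'I_(order G).

HB.instance Definition _ := gen_eqMixin fgraph.
HB.instance Definition _ := gen_choiceMixin fgraph.

Definition pairs (V : finType) : {set {set V}} := [set e : {set V} | #|e| == 2]%SET.

Definition edges (G : fgraph) : {set {set (vertex G)}} :=
  [set [set p.1; p.2] | p : vertex G * vertex G & adj p.1 p.2]%SET.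

Definition fhom (H G : fgraph) (h : vertex H -> vertex G) : Prop :=
  forall a b, adj a b -> adj (h a) (h b).

Definition fembed (H G : fgraph) : Prop :=
  exists h : vertex H -> vertex G,
    [/\ injective h, fhom h & forall a b, ~~ adj a b -> ~~ adj (h a) (h b)].

Definition fiso (H G : fgraph) : bool :=
  `[< exists2 h : vertex H -> vertex G,
        bijective h & forall a b, adj (h a) (h b) = adj a b >].

Lemma fiso_refl : reflexive fiso.
Proof. by move=> G; apply/asboolP; exists id => //; exists id. Qed.

Lemma fiso_sym : symmetric fiso.
Proof.
suff half G H : fiso G H -> fiso H G by move=> G H; apply/idP/idP => /half.
move=> /asboolP[h [k hk kh] hE]; apply/asboolP; exists k; first by exists h.
by move=> a b; rewrite -hE !kh.
Qed.

Lemma fiso_trans : transitive fiso.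
Proof.
move=> G H K /asboolP[h hB hE] /asboolP[k kB kE]; apply/asboolP.
by exists (k \o h); [exact: bij_comp | move=> a b /=; rewrite kE hE].
Qed.

Canonical fiso_equiv := EquivRel fiso fiso_refl fiso_sym fiso_trans.

(* Isomorphism types of nonempty finite graphs; [repr T] is a graph of
   type T. *)
Definition isotype := {eq_quot fiso_equiv}.
HB.instance Definition _ := Choice.on isotype.
HB.instance Definition _ := EqQuotient.on isotype.

Definition isotype_of (G : fgraph) : isotype := \pi_isotype G.

Definition isotype_le (H G : isotype) : Prop := fembed (repr H) (repr G).

Definition minimal_excluded (S : set isotype) : set isotype :=
  [set H | ~ S H /\ forall K, ~ S K -> isotype_le K H -> K = H].

(* The first clause is the condition on H and S under which the notion is
   defined. *)
Definition necessary (H : fgraph) (S : set isotype)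
    (B : {set {set (vertex H)}}) : Prop :=
  [/\ forall G, S G -> ~ fembed H (repr G),
      B \subset pairs (vertex H) :\: edges H &
      forall G, S G -> forall psi : vertex H -> vertex (repr G),
        injective psi -> fhom psi ->
        exists2 e, e \in B & (psi @: e)%SET \in edges (repr G)].

Section PhiSets.
Variables (S : language) (m n : nat) (phi : pformula S m n).

Definition phi_set (M : structure S) (A : set (power M n)) : Prop := A !=set0.

Definition graph_like_set (M : structure S) (A : set (power M n)) : Prop :=
  forall B : set (power M n), finite_set B -> B `<=` A -> `I_2 #<= B ->
    (consistent phi B <->
     forall C : set (power M n), C `<=` B -> C #= `I_2 -> consistent phi C).

Definition Sh (M : structure S) (A : set (power M n)) (G : fgraph)
    (theta : vertex G -> power M n) : Prop :=
  [/\ forall i, A (theta i),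
      forall i, exists x : power M m, psat phi x (theta i) &
      forall i j, i <> j ->
        (adj i j <-> exists x : power M m,
                       psat phi x (theta i) /\ psat phi x (theta j))].

Definition isoSh (M : structure S) (A : set (power M n)) : set isotype :=
  [set T | exists G theta, Sh A (G := G) theta /\ T = isotype_of G].

Variables (L : choiceType) (D : set_system L) (M : L -> structure S).

(* [a b] is the parameter of the b-th formula of the type. *)
Definition is_type (a : L -> power (ultraproduct D M) n) : Prop :=
  consistent phi (range a).

Definition realized (a : L -> power (ultraproduct D M) n) : Prop :=
  exists x : power (ultraproduct D M) m, forall b, psat phi x (a b).

Definition has_representatives_in (A : forall i, set (power (M i) n))
    (a : L -> power (ultraproduct D M) n) : Prop :=
  exists r : L -> forall i, power (M i) n,
    (forall b i, A i (r b i)) /\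
    (forall b, a b = fun k => uclass D (fun i => r b i k)).

End PhiSets.

Section FinsetFunctions.
Variables (L : choiceType) (D : set_system L).

Definition maps_into (f : {fset L} -> set L) : Prop := forall d, D (f d).

Definition graph_like_fun (f : {fset L} -> set L) : Prop :=
  forall d : {fset L}, (2 <= #|` d|)%N ->
    f d = \bigcap_(e in [set e : {fset L} | (e `<=` d)%fset /\ #|` e| = 2]) f e.

Definition multiplicative_refinement (f g : {fset L} -> set L) : Prop :=
  [/\ maps_into g, forall d, g d `<=` f d &
      forall d e, g (d `|` e)%fset = g d `&` g e].

Definition respects (H : fgraph) (B : {set {set (vertex H)}})
    (f : {fset L} -> set L) : Prop :=
  forall x : vertex H -> L, injective x ->
    \bigcap_(e in [set` edges H]) f [fset x a | a in e]%fset `<=`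
    \bigcup_(e in [set` B]) f [fset x a | a in e]%fset.

End FinsetFunctions.

(* Main.v *)
Require Import Defs.

Set Implicit Arguments.
Unset Strict Implicit.
Unset Printing Implicit Defensive.

(** For parameters with representatives [r], the Los map sends a finite set [d]
    of indices to the set of [i] at which [{phi(x; r b i) : b in d}] is
    satisfiable.  By Los's theorem the parameters define a type iff the Los map
    takes its values in [D]; and regularity, which spreads the indices over
    finite sets [s i] such that each [b] lies in [s i] for [D]-almost all [i],
    turns a multiplicative refinement of the Los map into a realization.

    The link with graphs is that a function [f] on finite sets of indices
    defines at each [i] a graph, joining [b] to [c] when [i] lies in
    [f {b, c}].  For the Los map of parameters in the [A i] the finite pieces
    of this graph lie in [isoSh (A i)], so the necessary sets [B H] force the
    condition on [f].  Conversely, under that condition no minimal excluded [H]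
    is an induced subgraph of a piece, since some pair of [B H], a non-edge of
    [H], would be an edge; hence the piece on [s i] is copied by elements of
    [A i].  These are representatives of a type, and where a realization of it
    satisfies the formulas is a multiplicative refinement of [f], because [f]
    and the [A i] are determined by pairs. *)

Local Open Scope classical_set_scope.
Local Open Scope card_scope.

Lemma choice_dep (I : Type) (T : I -> Type) (P : forall i, T i -> Prop) :
  (forall i, exists x, P i x) -> exists f : forall i, T i, forall i, P i (f i).
Proof.
by move=> exP; exists (fun i => projT1 (cid (exP i))) => i; case: cid.
Qed.

Lemma filter_choice (I : Type) (D : set_system I) (T : I -> Type)
    (P : forall i, T i -> Prop) :
  Filter D -> (forall i, inhabited (T i)) -> D [set i | exists x, P i x] ->
  exists f : forall i, T i, D [set i | P i (f i)].
Proof.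
move=> filterD T_inh DP.
have /choice_dep[f fP] : forall i, exists x, (exists y, P i y) -> P i x.
  move=> i; have [[x Px]|nP] := pselect (exists y, P i y); first by exists x.
  by case: (T_inh i) => x; exists x => /nP.
by exists f; apply: filterS DP => i /fP.
Qed.

Lemma ultra_setC (I : Type) (D : set_system I) (A : set I) :
  UltraFilter D -> D (~` A) <-> ~ D A.
Proof.
move=> ultraD; split=> [DCA DA|nDA]; last first.
  by have [] := in_ultra_setVsetC A ultraD.
by have /filter_ex[i []] : D (~` A `&` A) by exact: filterI.
Qed.

Lemma card_eq2P (T : Type) (A : set T) :
  A #= `I_2 <-> exists x y, x <> y /\ A = [set x; y].
Proof.
split=> [/eq_cardSP[x Ax /eq_cardSP[y [Ay yx]]]|[x [y [xy ->]]]].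
  rewrite II0 card_eq0 => /eqP Axy0; exists x, y; split; first exact/nesym.
  by rewrite -(setD1K Ax) -(@setD1K _ y (A `\ x)) // Axy0 setU0.
apply/eq_cardSP; exists x; first by left.
apply/eq_cardSP; exists y; first by split; [right|exact/nesym].
rewrite II0 card_eq0; apply/eqP; rewrite -subset0 => z [[[zx|zy] nzx] nzy].
  exact: nzx.
exact: nzy.
Qed.

Lemma finite_subset_range (T : choiceType) (U : Type) (f : T -> U)
    (C : set U) :
  finite_set C -> C `<=` range f -> exists d : {fset T}, C = f @` [set` d].
Proof.
move=> finC Cf; have [->|/set0P[c0 /Cf[b0 _ _]]] := eqVneq C set0.
  by exists fset0; rewrite set_fset0 image_set0.
have /choice[s fs] : forall c, exists b, C c -> f b = c.
  by move=> c; have [/Cf[b _ <-]|nC] := pselect (C c); [exists b|exists b0].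
have /finite_fsetP[d dE] : finite_set (s @` C) by exact: finite_image.
exists d; rewrite -dE image_comp.
rewrite -[LHS]image_id; apply: eq_imagel => c Cc /=; exact/esym/fs.
Qed.

Lemma cardfs2P (T : choiceType) (e : {fset T}) :
  reflect (exists b c, b != c /\ e = [fset b; c]%fset) (#|` e| == 2).
Proof.
apply: (iffP eqP) => [e2|[b [c [bc ->]]]]; last by rewrite cardfs2 bc.
have /fset0Pn[b be] : e != fset0 by rewrite -cardfs_gt0 e2.
move: e2; rewrite (cardfsD1 b) be add1n => -[/eqP/cardfs1P[c ec]].
have : c \in (e `\ b)%fset by rewrite ec inE.
rewrite !inE => /andP[cb _]; exists b, c.
by rewrite eq_sym -ec fsetD1K.
Qed.

Lemma imfset_set2 (V : finType) (T : choiceType) (x : V -> T) (a b : V) :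
  [fset x c | c in [set a; b]%SET]%fset = [fset x a; x b]%fset.
Proof.
apply/fsetP => y; apply/imfsetP/fset2P => [[c /=]|[]->].
- by rewrite !inE => /orP[]/eqP-> ->; [left|right].
- by exists a => //=; rewrite !inE eqxx.
- by exists b => //=; rewrite !inE eqxx orbT.
Qed.

Lemma imfset_imset (V W : finType) (T : choiceType) (x : W -> T) (h : V -> W)
    (e : {set V}) :
  [fset x b | b in (h @: e)%SET]%fset = [fset x (h a) | a in e]%fset.
Proof.
apply/fsetP => y; apply/imfsetP/imfsetP => /= -[].
  by move=> _ /imsetP[a ae ->] ->; exists a.
by move=> a ae ->; exists (h a) => //; exact: imset_f.
Qed.

Section Los.
Variables (S : language) (L : Type) (D : set_system L) (M : L -> structure S).
Hypothesis ultraD : UltraFilter D.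

Lemma uclass_eq (r s : forall i, M i) :
  uclass D r = uclass D s <-> D [set i | r i = s i].
Proof.
split=> [/(congr1 (@proj1_sig _ _)) /= rs|rs].
  by rewrite -[D _]/(ueq D r s) rs; exact: filterE.
suff rs' : ueq D r = ueq D s by apply: eq_exist; rewrite rs'.
by apply/seteqP; split=> t; apply: filterS2 rs => i /= ->.
Qed.

Lemma ureprK : cancel (@urepr S L D M) (@uclass S L D M).
Proof.
by case=> C exC; apply: eq_exist; rewrite /urepr; case: cid => r /= ->.
Qed.

Lemma urepr_fun (T : finType) (c : T -> ultraproduct D M)
    (r : T -> forall i, M i) :
  (forall k, c k = uclass D (r k)) ->
  D [set i | (fun k => urepr (c k) i) = r^~ i].
Proof.
move=> cE; have : D [set i | forall k, urepr (c k) i = r k i].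
  by apply: filter_forall => k; apply/uclass_eq; rewrite ureprK cE.
by apply: filterS => i /= rE; apply/funext.
Qed.

Definition uclass_fun (V : Type) (w : forall i, V -> M i) (x : V) :
  ultraproduct D M := uclass D (w^~ x).

Lemma uclass_fun_surj (V : Type) (v : V -> ultraproduct D M) :
  exists w : forall i, V -> M i, v = uclass_fun w.
Proof.
by exists (fun i x => urepr (v x) i); apply/funext => x; rewrite -[LHS]ureprK.
Qed.

Lemma uclass_fun_oapp (V : Type) (w : forall i, V -> M i)
    (r : forall i, M i) :
  uclass_fun (fun i => oapp (w i) (r i)) = oapp (uclass_fun w) (uclass D r).
Proof. by apply/funext => -[]. Qed.

Lemma eval_uclass_fun (V : Type) (w : forall i, V -> M i) (t : term S V) :
  eval (uclass_fun w) t = uclass D (fun i => eval (w i) t).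
Proof.
elim: t => //= s ts IH; apply/uclass_eq.
by apply: filterS (urepr_fun IH) => i /= ->.
Qed.

Theorem sat_uclass_fun (V : Type) (p : formula S V) (w : forall i, V -> M i) :
  sat p (uclass_fun w) <-> D [set i | sat p (w i)].
Proof.
elim: p w => {V}.
- by move=> V t u w /=; rewrite !eval_uclass_fun; exact: uclass_eq.
- move=> V s ts w.
  have tsE := urepr_fun (fun k => eval_uclass_fun w (ts k)).
  by split; apply: filterS2 tsE => i /= ->.
- by move=> V q IH w /=; rewrite IH -ultra_setC.
- move=> V q IHq r IHr w /=; rewrite IHq IHr; split=> [[Dq Dr]|Dqr].
    exact: filterI.
  by split; apply: filterS Dqr => i [].
- move=> V q IH w /=; split=> [[c]|].
    rewrite -[c]ureprK -[X in sat _ X]/(oapp (uclass_fun w) _).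
    rewrite -uclass_fun_oapp IH; apply: filterS => i qi.
    by exists (urepr c i).
  move=> /filter_choice[i|r]; first exact: carrier_inh.
  rewrite -(IH (fun i => oapp (w i) (r i))) uclass_fun_oapp => qr.
  by exists (uclass D r).
Qed.

Lemma psat_uclass_fun (m n : nat) (phi : pformula S m n)
    (x : forall i, power (M i) m) (y : forall i, power (M i) n) :
  psat phi (uclass_fun x) (uclass_fun y) <->
  D [set i | psat phi (x i) (y i)].
Proof.
pose w i j := match j with inl k => x i k | inr k => y i k end.
rewrite /psat (_ : (fun j => _) = uclass_fun w); first exact: sat_uclass_fun.
by apply/funext => -[].
Qed.

End Los.

Lemma isotype_of_eq (G H : fgraph) : isotype_of G = isotype_of H <-> fiso G H.
Proof. by split=> /eqmodP. Qed.

Lemma fiso_repr (G : fgraph) : fiso G (repr (isotype_of G)).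
Proof. by apply/isotype_of_eq; rewrite /isotype_of reprK. Qed.

Lemma fembedP (H G : fgraph) :
  fembed H G <-> exists2 h : vertex H -> vertex G,
    injective h & forall a b, adj (h a) (h b) = adj a b.
Proof.
split=> [[h [h_inj h_hom h_nadj]]|[h h_inj hE]]; exists h => //.
  by move=> a b; case: (boolP (adj a b)) => [/h_hom|/h_nadj/negbTE].
by split=> // a b; rewrite hE.
Qed.

Lemma fiso_fembed (H G : fgraph) : fiso H G -> fembed H G.
Proof. by move=> /asboolP[h /bij_inj h_inj hE]; apply/fembedP; exists h. Qed.

Lemma fembed_trans (H G K : fgraph) : fembed H G -> fembed G K -> fembed H K.
Proof.
move=> /fembedP[h h_inj hE] /fembedP[k k_inj kE]; apply/fembedP.
by exists (k \o h) => [|a b] /=; [exact: inj_comp|rewrite kE hE].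
Qed.

Lemma fembed_fiso (H G : fgraph) :
  fembed H G -> (order G <= order H)%N -> fiso H G.
Proof.
move=> /fembedP[h h_inj hE] GH; apply/asboolP; exists h => //.
by apply: inj_card_bij => //; rewrite !card_ord.
Qed.

Lemma exists_minimal_excluded_le (S : set isotype) (T : isotype) :
  ~ S T -> exists2 H, minimal_excluded S H & isotype_le H T.
Proof.
have [k] := ubnP (order (repr T)); elim: k T => // k IH T Tk nST.
have [T_min|] := pselect (minimal_excluded S T).
  by exists T => //; apply: fiso_fembed; exact: fiso_refl.
move=> /not_andP[//|/existsNP[K /not_implyP[nSK /not_implyP[KT nKT]]]].
have K_lt_T : (order (repr K) < order (repr T))%N.
  rewrite ltnNge; apply/negP => TK; apply: nKT.
  by have /isotype_of_eq := fembed_fiso KT TK; rewrite /isotype_of !reprK.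
have [|H H_min HK] := IH K _ nSK; first exact: leq_trans K_lt_T Tk.
by exists H => //; exact: fembed_trans HK KT.
Qed.

Lemma isotype_of_mem (S : set isotype) (G : fgraph) :
  (forall H, minimal_excluded S H -> ~ fembed (repr H) G) -> S (isotype_of G).
Proof.
move=> noH; apply: contrapT => /exists_minimal_excluded_le[H H_min HG].
apply: noH H_min _; apply: fembed_trans HG (fiso_fembed _).
by rewrite fiso_sym fiso_repr.
Qed.

Lemma edgesP (G : fgraph) (e : {set vertex G}) :
  reflect (exists a b, adj a b /\ e = [set a; b]%SET) (e \in edges G).
Proof.
apply: (iffP imsetP) => [[[a b]]|[a [b [ab ->]]]]; last first.
  by exists (a, b); rewrite ?inE.
by rewrite inE /= => ab ->; exists a, b.
Qed.

Lemma card_edge (G : fgraph) (e : {set vertex G}) : e \in edges G -> #|e| = 2.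
Proof.
move=> /edgesP[a [b [ab ->]]]; apply/eqP/cards2P; exists a, b; split=> //.
by apply: contraTneq ab => ->; rewrite adj_irr.
Qed.

Lemma set2_edges (G : fgraph) (a b : vertex G) :
  ([set a; b]%SET \in edges G) = adj a b.
Proof.
apply/edgesP/idP => [[c [d [cd ab_cd]]]|ab]; last by exists a, b.
have [/set2P[]cE /set2P[]dE] : c \in [set a; b]%SET /\ d \in [set a; b]%SET.
- by rewrite ab_cd set21 set22.
- by rewrite cE dE adj_irr in cd.
- by rewrite cE dE in cd.
- by rewrite cE dE adj_sym in cd.
- by rewrite cE dE adj_irr in cd.
Qed.

Lemma imset_edges (H G : fgraph) (h : vertex H -> vertex G) :
  injective h -> (forall a b, adj (h a) (h b) = adj a b) ->
  forall e : {set vertex H}, ((h @: e)%SET \in edges G) = (e \in edges H).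
Proof.
move=> h_inj hE e.
have [/cards2P[a [b [_ ->]]]|e2] := boolP (#|e| == 2).
  by rewrite imsetU !imset_set1 !set2_edges.
by apply/idP/idP => /card_edge; rewrite ?card_imset // => /eqP;
  rewrite (negbTE e2).
Qed.

Lemma necessary_fhom (H : fgraph) (S : set isotype)
    (B : {set {set vertex H}}) (G : fgraph) (h : vertex H -> vertex G) :
  necessary S B -> S (isotype_of G) -> injective h -> fhom h ->
  exists2 e, e \in B & (h @: e)%SET \in edges G.
Proof.
move=> [_ _ B_nec] SG h_inj h_hom.
have /asboolP[k /bij_inj k_inj kE] := fiso_repr G.
have [||e eB] := B_nec _ SG (k \o h); first exact: inj_comp.
  by move=> a b /h_hom; rewrite -kE.
by rewrite imset_comp imset_edges //; exists e.
Qed.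

Section PairGraph.
Variables (T : choiceType) (P : {fset T} -> Prop).
Variables (k : nat) (k_gt0 : (0 < k)%N) (t : 'I_k -> T).

Definition pair_adj : rel 'I_k :=
  fun a b => (a != b) && `[< P [fset t a; t b]%fset >].

Lemma pair_adj_sym : symmetric pair_adj.
Proof. by move=> a b; rewrite /pair_adj eq_sym fsetUC. Qed.

Lemma pair_adj_irr : irreflexive pair_adj.
Proof. by move=> a; rewrite /pair_adj eqxx. Qed.

Definition pair_graph : fgraph := FGraph k_gt0 pair_adj_sym pair_adj_irr.

Lemma edges_pair_graph (e : {set vertex pair_graph}) :
  (e \in edges pair_graph) = (#|e| == 2) && `[< P [fset t a | a in e]%fset >].
Proof.
have [/cards2P[a [b [ab ->]]]|e2] := boolP (#|e| == 2); last first.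
  by apply: contraNF e2 => /card_edge ->.
by rewrite set2_edges imfset_set2 /= /pair_adj ab.
Qed.

End PairGraph.

Section Satisfiability.
Variables (S : language) (m n : nat) (phi : pformula S m n) (M : structure S).
Implicit Types A C : set (power M n).

Lemma power_inhabited (k : nat) : inhabited (power M k).
Proof. by case: (carrier_inh M) => x; exact: inhabits (fun=> x). Qed.

Definition jointly_satisfiable (T : choiceType) (r : T -> power M n)
    (d : {fset T}) : Prop :=
  exists x : power M m, forall b, b \in d -> psat phi x (r b).

Section Family.
Variables (T : choiceType) (r : T -> power M n).

Lemma jointly_satisfiable_fset0 : jointly_satisfiable r fset0.
Proof. by case: (power_inhabited m) => x; exists x. Qed.

Lemma jointly_satisfiable_sub (d e : {fset T}) :
  (d `<=` e)%fset -> jointly_satisfiable r e -> jointly_satisfiable r d.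
Proof. by move=> /fsubsetP de [x xP]; exists x => b /de/xP. Qed.

Lemma jointly_satisfiable_fset2 (b c : T) :
  jointly_satisfiable r [fset b; c]%fset <->
  exists x : power M m, psat phi x (r b) /\ psat phi x (r c).
Proof.
split=> [[x xP]|[x [xb xc]]]; exists x; last by move=> e /fset2P[]->.
by split; apply: xP; rewrite ?fset21 ?fset22.
Qed.

Lemma jointly_satisfiable_fset1 (b : T) :
  jointly_satisfiable r [fset b]%fset <->
  exists x : power M m, psat phi x (r b).
Proof.
rewrite -[[fset b]%fset]fsetUid jointly_satisfiable_fset2.
by split=> -[x]; [case; exists x|exists x].
Qed.

Definition codes_pairs (P : {fset T} -> Prop) (d : {fset T}) : Prop :=
  {in d &, forall b c,
    jointly_satisfiable r [fset b; c]%fset <-> P [fset b; c]%fset}.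

Lemma consistent_range :
  consistent phi (range r) <-> forall d, jointly_satisfiable r d.
Proof.
split=> [r_cons d|r_sat C /finite_subset_range finC /finC[d ->]].
  have [||x xP] := r_cons (r @` [set` d]); first exact: finite_image.
    by move=> _ [b _ <-]; exists b.
  by exists x => b bd; apply: xP; exists b.
by have [x xP] := r_sat d; exists x => _ [b bd <-]; exact: xP.
Qed.

End Family.

Lemma graph_like_set_consistent A C :
  graph_like_set phi A -> finite_set C -> C `<=` A ->
  (forall y z, C y -> C z ->
    exists x : power M m, psat phi x y /\ psat phi x z) ->
  consistent phi C.
Proof.
move=> A_graph_like finC CA pairC.
have [[y [z [Cy Cz yz]]]|C_sub1] :=
    pselect (exists y z, [/\ C y, C z & y <> z]).
  have C_ge2 : `I_2 #<= C.
    have /card_eq2P yz2 : exists u v, u <> v /\ [set y; z] = [set u; v].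
      by exists y, z.
    by rewrite -(card_le_eql yz2); apply: subset_card_le => _ [->|->].
  apply/(A_graph_like _ finC CA C_ge2) => E EC /card_eq2P[u [v [_ E_uv]]].
  have [Cu Cv] : C u /\ C v by split; apply: EC; rewrite E_uv; [left|right].
  have [x [xu xv]] := pairC u v Cu Cv.
  by move=> F _ FE; exists x => w /FE; rewrite E_uv => -[]->.
move=> E _ EC; have [->|/set0P[y Ey]] := eqVneq E set0.
  by case: (power_inhabited m) => x; exists x.
have [x [xy _]] := pairC y y (EC y Ey) (EC y Ey); exists x => z Ez.
suff -> : z = y by [].
by apply: contrapT => zy; apply: C_sub1; exists z, y; split=> //; exact: EC.
Qed.

Lemma graph_like_jointly_satisfiable (T : choiceType) A (r : T -> power M n)
    (d : {fset T}) :
  graph_like_set phi A -> (forall b, b \in d -> A (r b)) ->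
  jointly_satisfiable r d <->
  {in d &, forall b c, jointly_satisfiable r [fset b; c]%fset}.
Proof.
move=> A_graph_like rA; split=> [r_sat b c bd cd|r_pairs].
  by apply: jointly_satisfiable_sub r_sat; rewrite fsubUset !fsub1set bd.
have finC : finite_set (r @` [set` d]) by exact: finite_image.
have C_cons : consistent phi (r @` [set` d]).
  apply: graph_like_set_consistent A_graph_like finC _ _.
    by move=> _ [b bd <-]; exact: rA.
  by move=> _ _ [b bd <-] [c cd <-]; exact/jointly_satisfiable_fset2/r_pairs.
have [x xP] := C_cons _ finC (@subset_refl _ _).
by exists x => b bd; apply: xP; exists b.
Qed.

Lemma isoShP A (G : fgraph) :
  isoSh phi A (isotype_of G) <-> exists theta, Sh phi A (G := G) theta.
Proof.
split=> [|[theta theta_Sh]]; last by exists G, theta.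
move=> [H [theta [[thetaA theta_sat theta_adj]]]].
move=> /isotype_of_eq/asboolP[h /bij_inj h_inj hE]; exists (theta \o h).
split=> [a|a|a b ab] /=; [exact: thetaA|exact: theta_sat|].
by rewrite -hE; apply: theta_adj => /h_inj.
Qed.

Lemma Sh_pair_graph (T : choiceType) (k : nat) (k_gt0 : (0 < k)%N) A
    (r : T -> power M n) (t : 'I_k -> T) :
  (forall v, A (r (t v))) ->
  (forall v, jointly_satisfiable r [fset t v]%fset) ->
  Sh phi A (G := pair_graph (jointly_satisfiable r) k_gt0 t) (r \o t).
Proof.
move=> rA r_sat; split=> [v|v|a b /eqP ab] /=.
- exact: rA.
- exact/jointly_satisfiable_fset1/r_sat.
rewrite /pair_adj ab -jointly_satisfiable_fset2.
by split=> /asboolP.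
Qed.

Lemma isoSh_pair_graph_codes_pairs (T : choiceType) A (P : {fset T} -> Prop)
    (d : {fset T}) (d_gt0 : (0 < #|{: d}|)%N) :
  isoSh phi A
    (isotype_of (pair_graph P d_gt0 (fun v => fsval (enum_val v)))) ->
  {in d, forall b, P [fset b]%fset} ->
  exists2 theta : T -> power M n, forall b, A (theta b) & codes_pairs theta P d.
Proof.
move=> /isoShP[th [thA th_sat th_adj]] P1.
pose v (b : T) : 'I_#|{: d}| :=
  oapp enum_rank (Ordinal d_gt0) (insub b : option d).
exists (th \o v) => [b|b c bd cd]; first exact: thA.
have vK e : e \in d -> fsval (enum_val (v e)) = e.
  by move=> ed; rewrite /v insubT /= enum_rankK.
rewrite jointly_satisfiable_fset2; have [->|bc] := eqVneq b c.
  rewrite fsetUid; split=> _; first exact: P1.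
  by have [x xv] := th_sat (v c); exists x.
have vbc : v b != v c.
  by apply: contra_neq bc => vbc; rewrite -(vK b bd) vbc vK.
rewrite /= -th_adj; last exact/eqP.
by rewrite /= /pair_adj vbc !vK //; split=> /asboolP.
Qed.

End Satisfiability.

Lemma isoSh_sub_satisfiable (S : language) (m n : nat) (phi : pformula S m n)
    (M N : structure S) (A : set (power M n)) (C : set (power N n)) :
  isoSh phi A `<=` isoSh phi C ->
  (exists y, A y /\ exists x : power M m, psat phi x y) ->
  exists y, C y /\ exists x : power N m, psat phi x y.
Proof.
move=> AC [y [Ay y_sat]]; pose G := pair_graph
  (jointly_satisfiable phi (fun _ : unit => y)) (ltn0Sn 0) (fun=> tt).
have /isoShP[theta [thetaC theta_sat _]] : isoSh phi C (isotype_of G).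
  apply: AC; apply/isoShP; exists (fun=> y).
  by apply: Sh_pair_graph => // v; exact/jointly_satisfiable_fset1.
by exists (theta ord0).
Qed.

Section FinsetFunctions.
Variables (L : choiceType) (D : set_system L).
Implicit Types (f g : {fset L} -> set L) (d : {fset L}).

Lemma graph_like_funP f :
  graph_like_fun f <-> forall d i, (2 <= #|` d|)%N ->
    f d i <-> {in d &, forall b c, b != c -> f [fset b; c]%fset i}.
Proof.
have pairsE d i :
    (\bigcap_(e in [set e | (e `<=` d)%fset /\ #|` e| = 2]) f e) i <->
    {in d &, forall b c, b != c -> f [fset b; c]%fset i}.
  split=> [fi b c bd cd bc|fi e [/fsubsetP ed /eqP/cardfs2P[b [c [bc ebc]]]]].
    by apply: fi; rewrite /= fsubUset !fsub1set bd cardfs2 bc.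
  by rewrite ebc; apply: fi => //; apply: ed; rewrite ebc ?fset21 ?fset22.
split=> f_gl d; first by move=> i d2; rewrite (f_gl d d2) pairsE.
by move=> d2; apply/seteqP; split=> i; rewrite (pairsE d i) -f_gl.
Qed.

Lemma multiplicative_bigcap g d :
  (forall d e, g (d `|` e)%fset = g d `&` g e) -> d != fset0 ->
  g d = \bigcap_(b in [set` d]) g [fset b]%fset.
Proof.
move=> gU; elim/fset1U_rect: d => [|b d _ IH _]; first by rewrite eqxx.
rewrite set_fsetU1 bigcap_setU1.
have [->|/IH <-] := eqVneq (d : {fset L}) fset0; last exact: gU.
by rewrite fsetU0 set_fset0 bigcap_set0 setIT.
Qed.

Lemma graph_like_fun_refinement f (Y : L -> set L) :
  Filter D -> maps_into D f -> graph_like_fun f -> (forall b, D (Y b)) ->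
  (forall b c, Y b `&` Y c `<=` f [fset b; c]%fset) ->
  exists g, multiplicative_refinement D f g.
Proof.
move=> filterD fD /graph_like_funP f_gl YD Yf.
exists (fun d => f fset0 `&` \bigcap_(b in [set` d]) Y b); split=> [d|d i|d e].
- by apply: filterI; [exact: fD|apply: filter_bigI => b _].
- move=> [f0 Yd]; have [d2|] := leqP 2 #|` d|.
    by apply/(f_gl d i d2) => b c bd cd _; apply: Yf; split; exact: Yd.
  rewrite ltnS leq_eqVlt ltnS leqn0 cardfs_eq0.
  move=> /orP[/cardfs1P[b db]|/eqP-> //].
  have Yb : Y b i by apply: Yd; rewrite db /= fset11.
  by rewrite db -[[fset b]%fset]fsetUid; exact: Yf.
- by rewrite setIACA setIid set_fsetU bigcap_setU.
Qed.

Lemma regular_system_fset :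
  regular_system D -> exists s : L -> {fset L}, forall b, D [set i | b \in s i].
Proof.
move=> [E [ED]]; rewrite card_eq_sym => /card_set_bijP[X [X_fun X_inj _]] E_fin.
have /choice_dep[s sP] : forall i, exists d : {fset L},
    [set b | X b i] = [set` d].
  move=> i; apply/finite_fsetP.
  have X_injon : {in [set b | X b i] &, injective X}.
    by move=> b c _ _; apply: X_inj; rewrite inE.
  rewrite -(eq_finite_set (inj_card_eq X_injon)).
  by apply: sub_finite_set (E_fin i) => _ [b Xbi <-]; split=> //; exact: X_fun.
exists s => b; have -> : [set i | b \in s i] = X b.
  by apply/funext => i; exact/esym/(congr1 (@^~ b) (sP i)).
exact/ED/X_fun.
Qed.

Lemma not_fembed_pair_graph (H : fgraph) (B : {set {set vertex H}}) f (i : L)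
    (k : nat) (k_gt0 : (0 < k)%N) (t : 'I_k -> L) :
  B \subset pairs (vertex H) :\: edges H -> respects B f -> injective t ->
  ~ fembed H (pair_graph (f^~ i) k_gt0 t).
Proof.
move=> B_nonedges Bf t_inj /fembedP[h h_inj h_adj].
have hE := imset_edges h_inj h_adj.
have [e /= eH|e eB fe] := Bf (t \o h) (inj_comp t_inj h_inj) i.
  by move: eH; rewrite -hE edges_pair_graph imfset_imset => /andP[_ /asboolP].
have := fintype.subsetP B_nonedges e eB; rewrite !inE -hE edges_pair_graph.
by rewrite card_imset // imfset_imset andbC => /andP[-> /asboolP].
Qed.

End FinsetFunctions.

Section LosMap.
Variables (S : language) (m n : nat) (phi : pformula S m n).
Variables (L : choiceType) (D : set_system L) (M : L -> structure S).
Implicit Type r : L -> forall i, power (M i) n.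

Definition los_map r (d : {fset L}) : set L :=
  [set i | jointly_satisfiable phi (r^~ i) d].

Section Ultrafilter.
Hypothesis ultraD : UltraFilter D.

Lemma is_type_uclass_fun r :
  is_type phi (fun b => uclass_fun D (r b)) <-> maps_into D (los_map r).
Proof.
rewrite /is_type consistent_range; split=> r_sat d.
  have [v] := r_sat d; have [x ->] := uclass_fun_surj v => xP.
  have : D (\bigcap_(b in [set` d]) [set i | psat phi (x i) (r b i)]).
    by apply: filter_bigI => b bd; exact/psat_uclass_fun/xP.
  by apply: filterS => i xi; exists (x i).
have [i|x xP] := filter_choice _ _ (r_sat d); first exact: power_inhabited.
exists (uclass_fun D x) => b bd; apply/psat_uclass_fun.
by apply: filterS xP => i /(_ b bd).
Qed.

Lemma realized_uclass_fun r :
  realized phi (fun b => uclass_fun D (r b)) <->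
  exists x : forall i, power (M i) m,
    forall b, D [set i | psat phi (x i) (r b i)].
Proof.
split=> [[v]|[x xP]].
  have [x ->] := uclass_fun_surj v => xP.
  by exists x => b; exact/psat_uclass_fun.
by exists (uclass_fun D x) => b; exact/psat_uclass_fun.
Qed.

Lemma realized_of_refinement r (g : {fset L} -> set L) :
  regular_system D -> multiplicative_refinement D (los_map r) g ->
  realized phi (fun b => uclass_fun D (r b)).
Proof.
move=> /regular_system_fset[s sD] [gD g_sub gU]; apply/realized_uclass_fun.
pose d i := [fset b in s i | `[< g [fset b]%fset i >]]%fset.
have /choice_dep[x xP] : forall i, jointly_satisfiable phi (r^~ i) (d i).
  move=> i; have [->|d_neq0] := eqVneq (d i) fset0.
    exact: jointly_satisfiable_fset0.
  apply: g_sub; rewrite (multiplicative_bigcap gU d_neq0) => b /=.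
  by rewrite !inE => /andP[_ /asboolP].
exists x => b; apply: filterS2 (sD b) (gD [fset b]%fset) => i bs gb.
by apply: xP; rewrite !inE bs; exact/asboolP.
Qed.

End Ultrafilter.

Variable A : forall i : L, set (power (M i) n).
Arguments A : clear implicits.
Hypothesis A_graph_like : forall i, graph_like_set phi (A i).

Lemma graph_like_los_map r :
  (forall b i, A i (r b i)) -> graph_like_fun (los_map r).
Proof.
move=> rA; apply/graph_like_funP => d i d2.
rewrite /los_map /= (graph_like_jointly_satisfiable (@A_graph_like i)) //.
split=> r_pairs b c bd cd; first by move=> _; exact: r_pairs.
have [<-|] := eqVneq b c; last exact: r_pairs.
have /fset0Pn[e] : (d `\ b)%fset != fset0.
  by rewrite -cardfs_gt0; move: d2; rewrite (cardfsD1 b) bd.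
rewrite !inE eq_sym => /andP[be ed].
apply: jointly_satisfiable_sub (r_pairs b e bd ed be).
by rewrite fsetUid fsubsetUl.
Qed.

Variable shapes : set isotype.
Hypothesis A_isoSh : forall i, isoSh phi (A i) = shapes.

Lemma respects_los_map (H : fgraph) (B : {set {set vertex H}}) r :
  necessary shapes B -> (forall b i, A i (r b i)) ->
  (forall b i, los_map r [fset b]%fset i) -> respects B (los_map r).
Proof.
move=> B_nec rA r_sat x x_inj i r_edges.
pose G := pair_graph (jointly_satisfiable phi (r^~ i)) (order_gt0 H) x.
have G_shape : shapes (isotype_of G).
  rewrite -(A_isoSh i); apply/isoShP; exists (fun v => r (x v) i).
  by apply: Sh_pair_graph => v; [exact: rA|exact: r_sat].
have id_hom : @fhom H G id.
  move=> a b ab; rewrite -set2_edges edges_pair_graph.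
  have ab_edge : [set a; b]%SET \in edges H by rewrite set2_edges.
  by rewrite (card_edge ab_edge) eqxx; apply/asboolP/r_edges.
have [e eB] := necessary_fhom B_nec G_shape (@inj_id _) id_hom.
by rewrite imset_id edges_pair_graph => /andP[_ /asboolP re]; exists e.
Qed.

(* An isolated vertex of an excluded graph imposes nothing on the Los map,
   whereas [Sh] wants [phi(x; theta v)] satisfiable for every vertex [v]: the
   representatives have to be changed, off a set in [D], so as to be satisfiable
   at every index. *)
Lemma satisfiable_representatives (a : L -> power (ultraproduct D M) n) :
  UltraFilter D -> is_type phi a -> has_representatives_in A a ->
  exists r, [/\ forall b i, A i (r b i), forall b i, los_map r [fset b]%fset i &
                a = fun b => uclass_fun D (r b)].
Proof.
move=> ultraD + [q [qA /funext aE]]; rewrite aE => /is_type_uclass_fun qD.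
have /choice_dep[y yP] i : exists y, A i y /\ exists x, psat phi x y.
  have /filter_ex[j /jointly_satisfiable_fset1 q_sat] := qD [fset i]%fset.
  have Aji : isoSh phi (A j) `<=` isoSh phi (A i) by rewrite !A_isoSh.
  by apply: isoSh_sub_satisfiable Aji _; exists (q i j).
pose r b i := if `[< los_map q [fset b]%fset i >] then q b i else y i.
exists r; split=> [b i|b i|].
- by rewrite /r; case: asboolP => _; [exact: qA|exact: (yP i).1].
- apply/jointly_satisfiable_fset1; rewrite /r.
  by case: asboolP => [/jointly_satisfiable_fset1|_]; [|exact: (yP i).2].
apply/funext => b; apply/funext => k; apply/uclass_eq.
by apply: filterS (qD [fset b]%fset) => i qi; rewrite /= /r asboolT.
Qed.

Lemma maps_into_los_map r (f : {fset L} -> set L) (d : L -> {fset L}) :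
  Filter D -> maps_into D f -> graph_like_fun f ->
  (forall b i, A i (r b i)) -> (forall b, D [set i | b \in d i]) ->
  (forall i, codes_pairs phi (r^~ i) (f^~ i) (d i)) ->
  maps_into D (los_map r).
Proof.
move=> filterD fD /graph_like_funP f_gl rA dD r_codes e.
have e_sub_d : D (\bigcap_(b in [set` e]) [set i | b \in d i]).
  by apply: filter_bigI => b _; exact: dD.
have f_fset1 : D (\bigcap_(b in [set` e]) f [fset b]%fset).
  by apply: filter_bigI => b _; exact: fD.
apply: filterS3 e_sub_d f_fset1 (fD e) => i ed f1 fe.
apply/(graph_like_jointly_satisfiable (@A_graph_like i)) => // b c be ce.
apply/r_codes; [exact: ed|exact: ed|].
have [<-|bc] := eqVneq b c; first by rewrite fsetUid; exact: f1.
have /fsubset_leq_card : ([fset b; c] `<=` e)%fset.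
  by rewrite fsubUset !fsub1set be.
by rewrite cardfs2 bc => e2; exact: (f_gl e i e2).1.
Qed.

Section CodesPairs.
Hypothesis A_phi_set : forall i, phi_set (A i).
Variable B : forall H : isotype, {set {set vertex (repr H)}}.
Hypothesis B_necessary : forall H, minimal_excluded shapes H ->
  necessary shapes (B H).
Variable f : {fset L} -> set L.
Hypothesis f_respects : forall H, minimal_excluded shapes H -> respects (B H) f.

Lemma exists_codes_pairs_at (i : L) (d : {fset L}) :
  {in d, forall b, f [fset b]%fset i} ->
  exists2 theta : L -> power (M i) n,
    forall b, A i (theta b) & codes_pairs phi theta (f^~ i) d.
Proof.
move=> f1; have [->|/fset0Pn[b bd]] := eqVneq d fset0.
  by have [y Ay] := A_phi_set i; exists (fun=> y).
have d_gt0 : (0 < #|{: d}|)%N by apply/card_gt0P; exists [` bd]%fset.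
apply: (isoSh_pair_graph_codes_pairs (P := f^~ i) (d_gt0 := d_gt0)) => //.
rewrite A_isoSh; apply: isotype_of_mem => H H_min.
have [_ B_nonedges _] := B_necessary H_min.
apply: not_fembed_pair_graph B_nonedges (f_respects H_min) _.
exact: inj_comp val_inj enum_val_inj.
Qed.

Lemma exists_codes_pairs : UltraFilter D -> regular_system D -> maps_into D f ->
  exists r (d : L -> {fset L}),
    [/\ forall b i, A i (r b i), forall b, D [set i | b \in d i] &
        forall i, codes_pairs phi (r^~ i) (f^~ i) (d i)].
Proof.
move=> ultraD /regular_system_fset[s sD] fD.
pose d i := [fset b in s i | `[< f [fset b]%fset i >]]%fset.
have /choice_dep[theta thetaP] : forall i, exists theta : L -> power (M i) n,
    (forall b, A i (theta b)) /\ codes_pairs phi theta (f^~ i) (d i).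
  move=> i; have [|theta thetaA theta_codes] := @exists_codes_pairs_at i (d i).
    by move=> b; rewrite !inE => /andP[_ /asboolP].
  by exists theta.
exists (fun b i => theta i b), d; split=> [b i|b|i].
- exact: (thetaP i).1.
- apply: filterS2 (sD b) (fD [fset b]%fset) => i /= bs fb.
  by rewrite !inE bs; exact/asboolP.
- exact: (thetaP i).2.
Qed.

End CodesPairs.

End LosMap.

Theorem theorem7p16 (L : choiceType) (infL : infinite_set [set: L])
    (D : set_system L) (ultraD : UltraFilter D) (regD : regular_system D)
    (S : language) (m n : nat) (phi : pformula S m n)
    (M : L -> structure S) (A : forall i : L, set (power (M i) n))
    (A_phi_set : forall i, phi_set (A i))
    (A_graph_like : forall i, graph_like_set phi (A i))
    (A_isoSh : forall i j, isoSh phi (A i) = isoSh phi (A j))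
    (i0 : L)
    (B : forall H : isotype, {set {set (vertex (repr H))}})
    (B_necessary : forall H, minimal_excluded (isoSh phi (A i0)) H ->
       necessary (isoSh phi (A i0)) (B H)) :
  (forall a : L -> power (ultraproduct D M) n,
     is_type phi a -> has_representatives_in A a -> realized phi a)
  <->
  (forall f : {fset L} -> set L,
     maps_into D f -> graph_like_fun f ->
     (forall H, minimal_excluded (isoSh phi (A i0)) H -> respects (B H) f) ->
     exists g : {fset L} -> set L, multiplicative_refinement D f g).
Proof.
have isoSh_i0 i : isoSh phi (A i) = isoSh phi (A i0) by [].
split=> [realized_types f fD f_gl f_respects|refinable a a_type a_repr].
  have [r [d [rA dD r_codes]]] :=
    exists_codes_pairs isoSh_i0 A_phi_set B_necessary f_respects ultraD regD fD.
  have /realized_uclass_fun[x xP] : realized phi (fun b => uclass_fun D (r b)).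
    apply: realized_types; last by exists r.
    apply/is_type_uclass_fun; exact: maps_into_los_map r_codes.
  pose Y b := [set i | b \in d i] `&` [set i | psat phi (x i) (r b i)].
  apply: (graph_like_fun_refinement (Y := Y)) => // [b|b c i [[bd xb] [cd xc]]].
    exact: filterI (dD b) (xP b).
  by apply/(r_codes i b c bd cd)/jointly_satisfiable_fset2; exists (x i).
have [r [rA r_sat aE]] :=
  satisfiable_representatives isoSh_i0 ultraD a_type a_repr.
rewrite aE in a_type *; have [|||g] := refinable (los_map phi r).
- exact/is_type_uclass_fun.
- exact: (graph_like_los_map A_graph_like).
- by move=> H /B_necessary B_nec; exact: (respects_los_map isoSh_i0 B_nec).
exact: realized_of_refinement.
Qed.
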